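(* Let $n\ge2$, let $A$ be one of the design matrices $\mathcal Z_n$, $\mathcal C_n$, $\mathcal E_n$ of the $p_1$ model, let $P_A$ be its marginal polytope, $C_A$ its marginal cone, and $\mu:S_A\to P_A$, $\mu(p)=Ap$, the moment homeomorphism. Let $t\in P_A$. Then $t\in\mathrm{ri}(P_A)$ if and only if $t\in\mathrm{ri}(C_A)$, where $\mathrm{ri}$ denotes the relative interior. Furthermore, for every (nonempty) face $G$ of $P_A$ there exists one facial set $\mathcal F$ of $C_A$ such that $\mathcal F=\mathrm{supp}(p)$, where $p=\mu^{-1}(t)$, for each $t\in\mathrm{ri}(G)$.
   Context: Coordinates of $\mathbb R^{2n(n-1)}$ are indexed by $p_{ij}(a,b)$, $1\le i<j\le n$, $a,b\in\{0,1\}$ (enumerated as $1,\dots,2n(n-1)$, pairs in lexicographic order and within a pair in the order $(0,0),(1,0),(0,1),(1,1)$); write $p=(p_{1,2},\dots,p_{n-1,n})$ with $p_{i,j}\in\mathbb R^4$. Design matrices (the column of $p_{ij}(a,b)$ is the exponent vector of the given parameter monomial, rows being indexed by the parameters, the first $\binom n2$ rows by the $\lambda_{ij}$): - $\mathcal Z_n$: $p_{ij}(a,b)\mapsto \lambda_{ij}\alpha_i^a\alpha_j^b\beta_i^b\beta_j^a\theta^{a+b}$; - $\mathcal C_n$: $p_{ij}(a,b)\mapsto \lambda_{ij}\alpha_i^a\alpha_j^b\beta_i^b\beta_j^a\theta^{a+b}\rho^{\min(a,b)}$; - $\mathcal E_n$: $p_{ij}(a,b)\mapsto \lambda_{ij}\alpha_i^a\alpha_j^b\beta_i^b\beta_j^a\theta^{a+b}(\rho\rho_i\rho_j)^{\min(a,b)}$.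 $\Delta_3\subset\mathbb R^4$ is the standard simplex (probability vectors), and $D_n=\{(p_{1,2},p_{1,3},\dots,p_{n-1,n}) : p_{i,j}\in\Delta_3 \text{ for all } i<j\}$. The toric ideal of $A$ is $I_A=(p^u-p^v:u,v \text{ nonnegative integer vectors},\ Au=Av)$, $V_A\subset\mathbb R^{2n(n-1)}$ is its zero set, and $S_A=V_A\cap D_n$. The marginal polytope is $P_A=\{Ap:p\in D_n\}$. The map $\mu:S_A\to P_A$, $p\mapsto Ap$, is a homeomorphism (known result), so $\mu^{-1}(t)$ is well defined for $t\in P_A$. The marginal cone is $C_A=\mathrm{cone}(A)$, the set of nonnegative linear combinations of the columns $a_1,\dots,a_{2n(n-1)}$ of $A$. A set $\mathcal F\subseteq\{1,\dots,2n(n-1)\}$ is a facial set of $C_A$ if there is a vector $c$ with $c^\top a_i=0$ for all $i\in\mathcal F$ and $c^\top a_i<0$ for all $i\notin\mathcal F$. For a vector $x$, $\mathrm{supp}(x)=\{i:x_i\ne0\}$. *)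

(* Defs.v *)
From HB Require Import structures.
From mathcomp Require Import all_boot all_order all_algebra.
From mathcomp Require Import all_classical all_reals all_analysis.
(* Only the structures on polynomials are imported: the notations of [mpoly]
   clash with those of MathComp-Analysis. *)
From mathcomp Require Import (canonicals) mpoly.

Set Implicit Arguments.
Unset Strict Implicit.
Unset Printing Implicit Defensive.

Import Order.TTheory GRing.Theory Num.Theory.
Import numFieldNormedType.Exports.

Local Open Scope classical_set_scope.
Local Open Scope ring_scope.

Definition dyad (n : nat) : finType :=
  {ij : 'I_n * 'I_n | (ij.1 < ij.2)%N}.

Definition dyad_fst n (d : dyad n) : 'I_n := (val d).1.
Definition dyad_snd n (d : dyad n) : 'I_n := (val d).2.

(* The cells (a,b) of a dyad in the order (0,0), (1,0), (0,1), (1,1): the cell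
   number k is a + 2b.  Then [enum (coordinate n)], which numbers the coordinates
   of 'cV[R]_#|coordinate n|, lists dyads lexicographically and the four cells of a
   dyad in this order. *)
Definition cell_a (k : 'I_4) : nat := (k %% 2)%N.
Definition cell_b (k : 'I_4) : nat := (k %/ 2)%N.

Definition coordinate (n : nat) : finType := (dyad n * 'I_4)%type.

Lemma card_coordinate (n : nat) : #|coordinate n| = (2 * n * (n - 1))%N.
Proof.
have dyadE : #|dyad n| = 'C(n, 2).
  rewrite card_sig -sum1_card -(pair_big_dep xpredT
    (fun i j : 'I_n => (i < j)%N) (fun _ _ => 1%N)) /=.
  rewrite (exchange_big_dep xpredT) //= -bin2_sum big_mkord.
  apply: eq_bigr => j _.
  rewrite (big_ord_narrow (F := fun=> 1%N) (ltnW (ltn_ord j))).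
  by rewrite sum_nat_const card_ord muln1.
rewrite card_prod card_ord dyadE bin2 -(mulnA 2) subn1.
have half2 : (n * n.-1 = 2 * (n * n.-1)./2)%N.
  rewrite mul2n -[LHS]odd_double_half oddM.
  by case: n {dyadE} => //= n; rewrite andNb.
by rewrite [in RHS]half2 mulnC mulnA.
Qed.

Inductive p1_model := Zmodel | Cmodel | Emodel.

(* lambda_ij, alpha_i, beta_i, theta *)
Definition base_param (n : nat) : finType :=
  (dyad n + 'I_n + 'I_n + unit)%type.

(* [Cmodel] adds rho, and [Emodel] adds rho and the rho_i. *)
Definition param (m : p1_model) (n : nat) : finType :=
  match m with
  | Zmodel => base_param n
  | Cmodel => (base_param n + unit)%type
  | Emodel => (base_param n + unit + 'I_n)%type
  end.

(* Exponents in lambda_ij alpha_i^a alpha_j^b beta_i^b beta_j^a theta^(a+b). *)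
Definition base_exponent n (x : base_param n) (c : coordinate n) : nat :=
  let i := dyad_fst c.1 in let j := dyad_snd c.1 in
  let a := cell_a c.2 in let b := cell_b c.2 in
  match x with
  | inl (inl (inl d)) => (d == c.1)
  | inl (inl (inr k)) => (k == i) * a + (k == j) * b
  | inl (inr k) => (k == i) * b + (k == j) * a
  | inr _ => a + b
  end%N.

Definition recip n (c : coordinate n) : nat := minn (cell_a c.2) (cell_b c.2).

Definition exponent (m : p1_model) (n : nat) : param m n -> coordinate n -> nat :=
  match m return param m n -> coordinate n -> nat with
  | Zmodel => fun x c => base_exponent x c
  | Cmodel => fun x c =>
      match x with
      | inl y => base_exponent y c
      | inr _ => recip c
      end
  | Emodel => fun x c =>
      match x with
      | inl (inl y) => base_exponent y c
      | inl (inr _) => recip c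
      | inr k => ((k == dyad_fst c.1) + (k == dyad_snd c.1)) * recip c
      end%N
  end.

Definition design (m : p1_model) (n : nat) : 'M[nat]_(#|param m n|, #|coordinate n|) :=
  \matrix_(r, c) exponent (enum_val r) (enum_val c).

Section Toric.
Variables (R : realType) (k N : nat) (A : 'M[nat]_(k, N)).

Definition ideal_gen (S : comNzRingType) (G : set S) : set S :=
  [set f | exists (l : nat) (h g : 'I_l -> S),
     (forall i, G (g i)) /\ f = \sum_(i < l) h i * g i].

Definition monomial (u : 'cV[nat]_N) : mpoly.mpoly N R :=
  \prod_(i < N) mpoly.mpolyX R (mpoly.mnm1 i) ^+ u i 0.

Definition toric_ideal : set (mpoly.mpoly N R) :=
  ideal_gen [set f | exists u v : 'cV[nat]_N,
    A *m u = A *m v /\ f = monomial u - monomial v].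

Definition toric_variety : set 'cV[R]_N :=
  [set p | forall f, toric_ideal f -> mpoly.meval (fun i => p i 0) f = 0].

Definition real_mx : 'M[R]_(k, N) := map_mx (fun e : nat => e%:R) A.

Definition marginal_cone : set 'cV[R]_k :=
  [set t | exists x : 'cV[R]_N,
     (forall i, 0 <= x i 0) /\ t = \sum_i x i 0 *: col i real_mx].

Definition facial_set (F : {set 'I_N}) : Prop :=
  exists c : 'cV[R]_k,
    (forall i, i \in F -> (c^T *m col i real_mx) 0 0 = 0) /\
    (forall i, i \notin F -> (c^T *m col i real_mx) 0 0 < 0).

End Toric.

Definition supp (R : realType) (N : nat) (x : 'cV[R]_N) : {set 'I_N} :=
  [set i | x i 0 != 0]%SET.

Section ConvexGeometry.
Variables (R : realType) (k : nat).
Implicit Types (S P G : set 'cV[R]_k).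

Definition affine_hull S : set 'cV[R]_k :=
  [set y | exists (l : nat) (w : 'I_l -> R) (x : 'I_l -> 'cV[R]_k),
     [/\ forall i, S (x i), \sum_i w i = 1 & y = \sum_i w i *: x i]].

Definition ri S : set 'cV[R]_k :=
  [set x | S x /\ \forall y \near x, affine_hull S y -> S y].

(* A face is cut out by a valid inequality; P itself (c = 0, d = 0) and the
   empty set (c = 0, d = 1) are faces. *)
Definition is_face P G : Prop :=
  exists (c : 'cV[R]_k) (d : R),
    (forall x, P x -> (c^T *m x) 0 0 <= d) /\
    G = P `&` [set x | (c^T *m x) 0 0 = d].

End ConvexGeometry.

Definition simplex (R : realType) (l : nat) : set 'cV[R]_l :=
  [set q | (forall i, 0 <= q i 0) /\ \sum_i q i 0 = 1].

Section Model.
Variables (R : realType) (n k : nat) (A : 'M[nat]_(k, #|coordinate n|)).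

Definition block (p : 'cV[R]_#|coordinate n|) (d : dyad n) : 'cV[R]_4 :=
  \col_(l < 4) p (enum_rank (d, l)) 0.

Definition Dn : set 'cV[R]_#|coordinate n| :=
  [set p | forall d : dyad n, simplex (block p d)].

Definition toric_model : set 'cV[R]_#|coordinate n| := toric_variety A `&` Dn.

Definition mu (p : 'cV[R]_#|coordinate n|) : 'cV[R]_k := real_mx R A *m p.

Definition marginal_polytope : set 'cV[R]_k := mu @` Dn.

(* The inverse of mu restricted to the toric model (0 outside the image). *)
Definition mu_inv : 'cV[R]_k -> 'cV[R]_#|coordinate n| :=
  'pinv_(fun=> 0) toric_model mu.

End Model.

(* Main.v *)
Require Import Defs.
From mathcomp Require Import all_boot all_order all_algebra.
From mathcomp Require Import all_classical all_reals all_analysis.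
From mathcomp Require Import ring lra.
From mathcomp Require Import (canonicals) mpoly.

(* The rows of the lambda's make each column lie in exactly one block, so that
   P_A is the slice of C_A where these coordinates equal 1, and t is in the
   relative interior of either one iff t = A x for some x > 0. The same argument
   on a face G, which consists of the A x with x in D_n supported in a fixed F,
   gives for t in ri(G) some q in D_n with A q = t and supp q = F. A point p of
   the toric variety with A p = A q and supp p included in F has support F:
   otherwise an integer approximation of q - p in the kernel of A gives a binomial of
   I_A that does not vanish at p. Finally mu is onto (so that mu_inv t lies
   in S_A): given q in D_n, the maximizer over S_A of the likelihood
   prod_j x_j ^ q_j has the same image as q under A. *)

Set Implicit Arguments.
Unset Strict Implicit.
Unset Printing Implicit Defensive.

Import Order.TTheory GRing.Theory Num.Theory.
Import numFieldNormedType.Exports.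

Local Open Scope classical_set_scope.
Local Open Scope ring_scope.

(** * Signs, rational approximation and integer kernels *)

Lemma continuous_mulmx_coord (R : realType) (m n p : nat) (B : 'M[R]_(m, n)) i j :
  continuous (fun x : 'M[R]_(n, p) => (B *m x) i j).
Proof.
have -> : (fun x : 'M[R]_(n, p) => (B *m x) i j) =
          (fun x => \sum_l B i l * x l j).
  by apply/funext => x; rewrite mxE.
have addc : continuous (fun x : R * R => x.1 + x.2) by exact: add_continuous.
apply: (continuous_big addc) => l _ x.
by apply: continuousM; [exact: cst_continuous|exact: coord_continuous].
Qed.

Lemma near_sgz (R : realType) (T : topologicalType) (f : T -> R) (x : T) :
  continuous f -> f x != 0 -> \forall y \near x, sgz (f y) = sgz (f x).
Proof.
move=> cf; case: (ltgtP (f x) 0) => // fx0 _.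
  have H : nbhs (f x) [set r | r < 0] by exact: lt_nbhsl.
  have {}H := cf x _ H; near=> y; have /= fy : (f @^-1` [set r | r < 0]) y by near: y.
  by rewrite !ltr0_sgz.
have H : nbhs (f x) [set r | 0 < r] by exact: lt_nbhsr.
have {}H := cf x _ H; near=> y; have /= fy : (f @^-1` [set r | 0 < r]) y by near: y.
by rewrite !gtr0_sgz.
Unshelve. all: by end_near. Qed.

Lemma sgz_ratr (R : realFieldType) (x : rat) : sgz (ratr x : R) = sgz x.
Proof. by apply: (@intr_inj R); rewrite -sgrEz -ratr_sg sgrEz ratr_int. Qed.

Lemma rat_vec_common_denom (n : nat) (x : 'cV[rat]_n) :
  exists (d : rat) (w : 'cV[int]_n),
    0 < d /\ map_mx intr w = d *: x.
Proof.
pose d : int := \prod_i denq (x i 0).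
exists d%:~R, (\col_i (numq (x i 0) * \prod_(j | j != i) denq (x j 0))); split.
  by rewrite ltr0z; apply: prodr_gt0 => i _; exact: denq_gt0.
apply/colP => i; rewrite !mxE /d [in RHS](bigD1 i) //= !intrM numqE.
by ring.
Qed.

Lemma near_rat_vec (R : realType) (n : nat) (c : 'cV[R]_n) (P : set 'cV[R]_n) :
  nbhs c P -> exists q : 'cV[rat]_n, P (map_mx ratr q).
Proof.
move=> /nbhs_ballP[e /= e0 eP].
have /choice[q qE] : forall i, exists q : rat, ratr q \in `](c i 0 - e), (c i 0 + e)[.
  by move=> i; apply: rat_in_itvoo; lra.
exists (\col_i q i); apply: eP; split => // i j; rewrite !mxE ord1.
by move: (qE i); rewrite in_itv /= /ball /= ltr_distl; lra.
Qed.

(* The kernel of an integer matrix is spanned by rational vectors, hence its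
   rational points are dense. Zeroing the columns of [A] at the zeros of [z]
   beforehand lets the approximation keep these zeros. *)
Lemma int_kernel_sgz (R : realType) (k N : nat) (A : 'M[nat]_(k, N))
    (z : 'cV[R]_N) :
  real_mx R A *m z = 0 ->
  exists w : 'cV[int]_N, map_mx Posz A *m w = 0 /\
    forall i, sgz (w i 0) = sgz (z i 0).
Proof.
move=> Az0.
pose e i : nat := (z i 0 != 0).
pose B : 'M[rat]_(k, N) := \matrix_(i, j) (A i j * e j)%:R.
pose K := kermx B^T.
have Bz0 : map_mx ratr B *m z = 0.
  rewrite -Az0; apply/matrixP => i j; rewrite !mxE ord1; apply: eq_bigr => l _.
  rewrite !mxE ratr_nat natrM -mulrA /e.
  by case: eqP => [->|]; rewrite /= ?mulr0 // mul1r.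
(* Kernels commute with the field extension from [rat] to [R], so [z] is a real combination of
   rational kernel vectors; rational coefficients near [c^T] keep its nonzero signs. *)
have /submxP[c zE] : (z^T <= map_mx ratr K)%MS.
  by rewrite /K map_kermx; apply/sub_kermxP; rewrite -map_trmx -trmx_mul Bz0 trmx0.
pose C : 'M[R]_N := map_mx ratr K^T.
have {}zE : z = C *m c^T by rewrite -[LHS]trmxK zE trmx_mul map_trmx.
have : \forall x \near c^T, forall i, z i 0 != 0 ->
    sgz ((C *m x) i 0) = sgz (z i 0).
  apply: (filter_forall (F := nbhs c^T)) => i; have [->|zi0] := eqVneq (z i 0) 0.
    exact: nearW.
  near=> x => _; rewrite zE; near: x.
  by apply: (near_sgz (f := fun x => (C *m x) i 0));
    [exact: continuous_mulmx_coord|rewrite -zE].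
move=> /near_rat_vec[q qP].
have [d [w [d0 wE]]] := rat_vec_common_denom (K^T *m q).
(* Masking by [e] restores the zeros of [z] and turns a kernel vector of [B] into one of [A]. *)
exists (\col_i (w i 0 * (e i)%:Z)); split; last first.
  move=> i; rewrite mxE /e; have [->|zi0] := eqVneq (z i 0) 0.
    by rewrite mulr0 !sgz0.
  rewrite mulr1 -(qP i zi0) /C -map_mxM [in RHS]mxE.
  have /= := congr1 (fun M : 'cV_N => sgz (M i 0)) wE.
  rewrite !mxE sgzM (gtr0_sgz d0) mul1r.
  by rewrite sgz_ratr sgz_int.
apply/matrixP => i j; apply: (@intr_inj rat); rewrite ord1 !mxE rmorph_sum /=.
have BK : B *m K^T = 0 by rewrite -[LHS]trmxK trmx_mul trmxK mulmx_ker trmx0.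
rewrite [RHS](_ : _ = d * (B *m (K^T *m q)) i 0); last first.
  by rewrite mulmxA BK mul0mx mxE mulr0.
rewrite [in RHS]mxE mulr_sumr.
apply: eq_bigr => l _; rewrite !mxE !intrM.
have := congr1 (fun M : 'cV_N => M l 0) wE; rewrite !mxE => ->.
by rewrite natrM mulrCA [RHS]mulrC; ring.
Unshelve. all: by end_near. Qed.

(** * Binomial equations and supports *)

Lemma meval_monomial (R : realType) (N : nat) (u : 'cV[nat]_N) (x : 'I_N -> R) :
  mpoly.meval x (monomial R u) = \prod_i x i ^+ u i 0.
Proof.
rewrite /monomial rmorph_prod; apply: eq_bigr => i _.
by rewrite rmorphXn /= mpoly.mevalXU.
Qed.

Lemma toric_varietyP (R : realType) (k N : nat) (A : 'M[nat]_(k, N)) (p : 'cV[R]_N) :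
  toric_variety A p <->
  (forall u v : 'cV[nat]_N, A *m u = A *m v ->
     \prod_i p i 0 ^+ u i 0 = \prod_i p i 0 ^+ v i 0).
Proof.
split=> [pA u v Auv|pA f [l [h [g [gA ->]]]]].
  apply/eqP; rewrite -subr_eq0 -!(meval_monomial _ (fun i => p i 0)) -rmorphB.
  apply/eqP/pA; exists 1%N, (fun=> 1), (fun=> monomial R u - monomial R v).
  by split=> [_|]; [exists u, v|rewrite big_ord1 mul1r].
rewrite rmorph_sum big1 //= => i _; rewrite rmorphM /=.
have [u [v [Auv ->]]] := gA i.
by rewrite rmorphB /= !meval_monomial (pA u v Auv) subrr mulr0.
Qed.

(* An integer kernel vector [w] with the signs of [q - p] yields the binomial
   with exponents the negative and positive parts of [w]; if [p] vanished at a
   point of [supp q], exactly one of its two monomials would vanish at [p]. *)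
Lemma toric_supp (R : realType) (k N : nat) (A : 'M[nat]_(k, N)) (p q : 'cV[R]_N) :
  toric_variety A p -> (forall i, 0 <= q i 0) ->
  supp p \subset supp q -> real_mx R A *m p = real_mx R A *m q ->
  supp p = supp q.
Proof.
move=> /toric_varietyP pA q0 /fintype.subsetP pq Apq; apply/setP => i; apply/idP/idP.
  exact: pq.
rewrite !inE => qi; apply/negP => /eqP pi.
have [w [Aw wE]] : exists w : 'cV[int]_N, map_mx Posz A *m w = 0 /\
    forall i, sgz (w i 0) = sgz ((q - p) i 0).
  by apply: int_kernel_sgz; rewrite mulmxBr Apq subrr.
pose u : 'cV[nat]_N := \col_i (if 0 <= w i 0 then 0%N else absz (w i 0)).
pose v : 'cV[nat]_N := \col_i (if 0 <= w i 0 then absz (w i 0) else 0%N).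
have wuv l : (v l 0)%:Z - (u l 0)%:Z = w l 0.
  rewrite !mxE; case: leP => wl; first by rewrite subr0 gez0_abs.
  by rewrite ltz0_abs // opprK add0r.
have /pA : A *m u = A *m v.
  apply/matrixP => r j; rewrite ord1 {j}.
  have AE t : Posz ((A *m t) r 0) = \sum_l Posz (A r l) * Posz (t l 0).
    rewrite mxE; elim/big_rec2: _ => // l y x _ <-.
    by rewrite PoszD PoszM.
  have := congr1 (fun M : 'cV_k => M r 0) Aw; rewrite mxE [RHS]mxE => Awr.
  suff : Posz ((A *m v) r 0) - Posz ((A *m u) r 0) = 0.
    by move/eqP; rewrite subr_eq0 => /eqP [].
  rewrite -[RHS]Awr !AE -sumrB; apply: eq_bigr => l _.
  by rewrite -wuv -mulrBr; congr (_ * _); rewrite mxE.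
apply/eqP; rewrite [X in _ != X](bigD1 i) //= pi.
have wi : 0 < w i 0.
  by rewrite -sgz_gt0 wE mxE mxE pi oppr0 addr0 sgz_gt0 lt_neqAle eq_sym qi q0.
rewrite !mxE (ltW wi) expr0n absz_eq0 (gt_eqF wi) mul0r.
(* Where [w l 0] is negative, [p l 0] exceeds [q l 0] and is therefore positive. *)
apply/prodf_neq0 => l _; rewrite mxE; case: ifPn => [_|].
  by rewrite expr0 oner_eq0.
rewrite -ltNge -sgz_lt0 wE mxE mxE sgz_lt0 => qpl.
by rewrite expf_neq0 // gt_eqF //; have := q0 l; lra.
Qed.

(** * First-order condition, closedness and torus scaling *)

Lemma is_derive1_mulr (R : realType) (s a : R) : is_derive s 1 (fun s : R => s * a) a.
Proof.
rewrite (_ : (fun s => _) = (a \*: (@id R))).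
  by apply: is_derive_eq; rewrite /GRing.scale /= mulr1.
by apply/funext => x /=; rewrite mulrC.
Qed.

(** Both sides of the inequality vanish at [s = 0], so their difference [g] is maximal there and its
    derivative at 0 is zero. *)
Lemma expR_tangent (R : realType) (N : nat) (alpha : R) (p a : 'I_N -> R) :
  (forall s, s * alpha <= \sum_i p i * (expR (s * a i) - 1)) ->
  alpha = \sum_i p i * a i.
Proof.
move=> le_alpha.
pose h i (s : R) := p i * (expR (s * a i) - 1).
pose g (s : R) := s * alpha - (\sum_i h i) s.
have dh i (s : R) : is_derive s 1 (h i) (p i * (expR (s * a i) * a i)).
  have d := @is_derive1_comp R expR _ s _ _ (is_derive_expR _)
    (is_derive1_mulr s (a i)).
  rewrite (_ : h i = p i \*: ((expR \o (fun s => s * a i)) - cst 1)) //.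
  by apply: is_derive_eq; rewrite subr0.
have dg (s : R) : is_derive s 1 g (alpha - \sum_i p i * (expR (s * a i) * a i)).
  have d1 := is_derive1_mulr s alpha; have d2 := is_derive_sum (fun i => dh i s).
  exact: is_deriveB.
have g0 : g 0 = 0.
  by rewrite /g mul0r sub0r fct_sumE big1 ?oppr0 // => i _;
    rewrite /h mul0r expR0 subrr mulr0.
have : is_derive (0 : R) 1 g 0.
  apply: (@derive1_at_max _ _ (-1) 1) => //.
  - by rewrite in_itv /=; lra.
  - by move=> s _; rewrite g0 /g subr_le0 fct_sumE; exact: le_alpha.
move=> /@derive_val dg0; have /@derive_val := dg 0; rewrite dg0.
move=> /esym/eqP; rewrite subr_eq0 => /eqP ->.
by apply: eq_bigr => i _; rewrite mul0r expR0 mul1r.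
Qed.

(** The variety is an intersection of zero sets of continuous binomials. Row vectors match
    [rV_compact], which later gives the compact box. *)
Lemma closed_toric_variety (R : realType) (k N : nat) (A : 'M[nat]_(k, N)) :
  closed [set x : 'rV[R]_N | toric_variety A x^T].
Proof.
pose mon (u : 'cV[nat]_N) (x : 'rV[R]_N) := \prod_i x 0 i ^+ u i 0.
have cmon u : continuous (mon u).
  have mulc : continuous (fun x : R * R => x.1 * x.2) by exact: mul_continuous.
  apply: (continuous_big mulc) => i _ x.
  apply: (@continuous_comp _ _ _ (fun x : 'rV[R]_N => x 0 i) (fun r => r ^+ u i 0)).
    exact: coord_continuous.
  exact: exprn_continuous.
rewrite (_ : mkset _ = \bigcap_(uv in [set uv | A *m uv.1 = A *m uv.2])
    ((fun x => mon uv.1 x - mon uv.2 x) @^-1` [set r | r = 0])).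
  apply: closed_bigI => -[u v] _; apply: preimage_closed; last exact: closed_eq.
  by move=> x _; apply: continuousB; exact: cmon.
have monE u x : mon u x = \prod_i x^T i 0 ^+ u i 0.
  by apply: eq_bigr => i _; rewrite mxE.
apply/seteqP; split => x /=.
  by move=> /toric_varietyP xA [u v] /= /xA; rewrite -!monE => ->; rewrite subrr.
move=> xA; apply/toric_varietyP => u v Auv; rewrite -!monE.
by apply/eqP; rewrite -subr_eq0; apply/eqP; exact: (xA (u, v) Auv).
Qed.

(** The scaling multiplies the monomial of exponent [w] by [y ^+ (A *m w) r 0], a factor common to
    both sides of each binomial equation. *)
Lemma toric_variety_scale_row (R : realType) (k N : nat) (A : 'M[nat]_(k, N))
    (r : 'I_k) (y : R) (p : 'cV[R]_N) :
  toric_variety A p -> toric_variety A (\col_i (y ^+ A r i * p i 0)).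
Proof.
move=> /toric_varietyP pA; apply/toric_varietyP => u v Auv.
have scaleE (w : 'cV[nat]_N) : \prod_i (\col_j (y ^+ A r j * p j 0)) i 0 ^+ w i 0 =
    y ^+ (A *m w) r 0 * \prod_i p i 0 ^+ w i 0.
  rewrite mxE; elim/big_rec3: _ => [|i a b c _ ->]; first by rewrite mulr1.
  by rewrite mxE exprMn -exprM exprD; ring.
by rewrite !scaleE Auv (pA _ _ Auv).
Qed.

(** * Relative interiors of linear images *)

Lemma marginal_coneE (R : realType) (k N : nat) (A : 'M[nat]_(k, N)) :
  marginal_cone A =
  [set real_mx R A *m x | x in [set x : 'cV[R]_N | forall i, 0 <= x i 0]].
Proof.
have mulE (x : 'cV[R]_N) :
    \sum_i x i 0 *: col i (real_mx R A) = real_mx R A *m x.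
  apply/colP => r; rewrite summxE mxE; apply: eq_bigr => i _.
  by rewrite !mxE mulrC.
apply/seteqP; split => t /=.
  by move=> [x [x0 ->]]; exists x.
by move=> [x x0 <-]; exists x.
Qed.

Lemma affine_hull_coord (R : realType) (k : nat) (S : set 'cV[R]_k) r a y :
  (forall s, S s -> s r 0 = a) -> affine_hull S y -> y r 0 = a.
Proof.
move=> Sr [l [w [x [Sx w1 ->]]]]; rewrite summxE -[RHS]mul1r -w1 mulr_suml.
by apply: eq_bigr => i _; rewrite mxE Sr.
Qed.

Lemma affine_hull_image (R : realType) (k N : nat) (M : 'M[R]_(k, N))
    (X : set 'cV[R]_N) y :
  affine_hull [set M *m x | x in X] y -> exists z, y = M *m z.
Proof.
move=> [l [w [x [MX _ ->]]]].
have /choice[z zE] : forall i, exists z, M *m z = x i.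
  by move=> i; have [z _ <-] := MX i; exists z.
exists (\sum_i w i *: z i); rewrite mulmx_sumr; apply: eq_bigr => i _.
by rewrite -scalemxAr zE.
Qed.

(** The weights [1 + e] and [- e] place the points beyond [t] on the line from [s] in the affine
    hull, and these points tend to [t] as [e] tends to 0. *)
Lemma ri_extend (R : realType) (k : nat) (S : set 'cV[R]_k) (s t : 'cV[R]_k) :
  ri S t -> S s -> exists2 e, 0 < e & S (t + e *: (t - s)).
Proof.
move=> [St riS] Ss.
have tcvg : t + e *: (t - s) @[e --> (0 : R)] --> t + 0 *: (t - s).
  apply: cvgD; first exact: cvg_cst.
  exact: scalel_continuous.
rewrite scale0r addr0 in tcvg.
have {}riS : \forall e \near (0 : R)^'+, affine_hull S (t + e *: (t - s)) ->
    S (t + e *: (t - s)).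
  have tcvgr := cvg_at_right_filter tcvg; exact: (tcvgr _ riS).
near (0 : R)^'+ => e; exists e => //.
suff : affine_hull S (t + e *: (t - s)) by near: e.
exists 2%N, (fun i : 'I_2 => if i == 0 then 1 + e else - e),
  (fun i => if i == 0 then t else s).
split=> [i||]; first by case: ifP.
  by rewrite !big_ord_recl big_ord0 /=; ring.
by rewrite !big_ord_recl big_ord0 /= addr0 scalerDl scale1r scalerBr scaleNr addrA.
Unshelve. all: by end_near. Qed.

(** Extending the segment from [M *m x0] through [t] to some [M *m y] makes [t] a proper convex
    combination of the two; the same combination of [x0] and [y] is positive wherever [x0] is. *)
Lemma ri_image_pos (R : realType) (k N : nat) (M : 'M[R]_(k, N))
    (X : set 'cV[R]_N) (x0 : 'cV[R]_N) t :
  (forall x, X x -> forall i, 0 <= x i 0) ->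
  (forall x y a, X x -> X y -> 0 < a < 1 -> X (a *: x + (1 - a) *: y)) ->
  X x0 -> ri [set M *m x | x in X] t ->
  exists x, [/\ X x, M *m x = t & forall i, 0 < x0 i 0 -> 0 < x i 0].
Proof.
move=> Xpos Xconv Xx0 /ri_extend/(_ (ex_intro2 _ _ x0 Xx0 erefl))[e e0 [y Xy yE]].
have e1 : 1 + e != 0 by lra.
have a01 : 0 < e / (1 + e) < 1.
  by rewrite divr_gt0 ?ltr_pdivrMr; lra.
exists ((e / (1 + e)) *: x0 + (1 - e / (1 + e)) *: y); split.
- exact: Xconv.
- rewrite mulmxDr -!scalemxAr yE; apply/colP => i; rewrite !mxE; by field.
- move=> i x0i; rewrite !mxE; have yi := Xpos _ Xy i.
  by case/andP: a01 => a0 a1; apply: ltr_pwDl;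
    [exact: mulr_gt0|rewrite mulr_ge0 // subr_ge0 ltW].
Qed.

(** A linear map is open onto its image: with a pseudo-inverse [B], the preimage [x + B *m (y - t)]
    of [y] depends continuously on [y] and equals [x] at [t]. *)
Lemma near_pos_preimage (R : realType) (k N : nat) (M : 'M[R]_(k, N))
    (x : 'cV[R]_N) :
  (forall i, 0 < x i 0) ->
  \forall y \near M *m x, (exists z : 'cV[R]_N, y = M *m z) ->
    exists2 x' : 'cV[R]_N, (forall i, 0 < x' i 0) & y = M *m x'.
Proof.
move=> x0; pose B := pinvmx M; set t := M *m x.
have MB : M *m B *m M = M by rewrite mulmxKpV ?submx_refl.
have : \forall y \near t, forall i, (B *m t) i 0 - x i 0 < (B *m y) i 0.
  apply: (filter_forall (F := nbhs t)) => i.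
  have H : nbhs ((B *m t) i 0) [set r | (B *m t) i 0 - x i 0 < r].
    by apply: lt_nbhsr; rewrite gtrBl.
  exact: (continuous_mulmx_coord H).
move=> tB; near=> y => -[z yE].
exists (x + B *m (y - t)).
  move=> i; rewrite mulmxBr !mxE.
  have : (B *m t) i 0 - x i 0 < (B *m y) i 0 by move: i; near: y.
  by rewrite !mxE; lra.
rewrite mulmxDr mulmxA -/t yE /t -mulmxBr.
by rewrite (mulmxA (M *m B)) MB mulmxBr addrC subrK.
Unshelve. all: by end_near. Qed.

(** * Toric models on a product of simplices *)

Section BlockSimplex.
Variables (R : realType) (k N : nat) (A : 'M[nat]_(k, N)).
(** For the p_1 model, [b] sends a coordinate to its dyad and [lam] a dyad to the row of its lambda;
    [sec] witnesses that no block is empty. *)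
Variables (D : finType) (b : 'I_N -> D) (lam : D -> 'I_k) (sec : D -> 'I_N).
Hypothesis lamE : forall d i, A (lam d) i = (b i == d) :> nat.
Hypothesis secK : cancel sec b.

Definition block_simplex : set 'cV[R]_N :=
  [set p | (forall i, 0 <= p i 0) /\ forall d, \sum_(i | b i == d) p i 0 = 1].

Lemma real_mx_mulE (p : 'cV[R]_N) r :
  (real_mx R A *m p) r 0 = \sum_i (A r i)%:R * p i 0.
Proof. by rewrite mxE; apply: eq_bigr => i _; rewrite mxE. Qed.

Lemma block_sumE (p : 'cV[R]_N) d :
  (real_mx R A *m p) (lam d) 0 = \sum_(i | b i == d) p i 0.
Proof.
rewrite real_mx_mulE [RHS]big_mkcond; apply: eq_bigr => i _.
by rewrite lamE; case: (b i == d); rewrite ?mul1r ?mul0r.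
Qed.

Lemma block_simplexP (p : 'cV[R]_N) :
  block_simplex p <-> (forall i, 0 <= p i 0) /\
    (forall d, (real_mx R A *m p) (lam d) 0 = 1).
Proof. by split=> -[p0 pb]; split=> // d; move: (pb d); rewrite block_sumE. Qed.

(** Every block has mass 1, so weights constant on blocks, such as log-normalizers or blockwise
    optima, have a total independent of [p]. *)
Lemma sum_blocks (f : D -> R) (p : 'cV[R]_N) : block_simplex p ->
  \sum_i p i 0 * f (b i) = \sum_d f d.
Proof.
move=> [_ pb]; rewrite (partition_big b xpredT) //=; apply: eq_bigr => d _.
rewrite -[RHS]mul1r -(pb d) mulr_suml.
by apply: eq_bigr => i /eqP ->.
Qed.

Lemma block_simplex_le1 (p : 'cV[R]_N) i : block_simplex p -> p i 0 <= 1.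
Proof.
move=> [p0 pb]; rewrite -(pb (b i)) (bigD1 i) //= lerDl.
exact: sumr_ge0.
Qed.

(** Entry [lam d] of [A *m w] is the degree of the monomial in block [d], so scaling each block by
    its own factor respects the binomial equations. This permits normalization within the
    variety. *)
Lemma toric_variety_scale_block (g : D -> R) (p : 'cV[R]_N) :
  toric_variety A p -> toric_variety A (\col_i (g (b i) * p i 0)).
Proof.
move=> /toric_varietyP pA; apply/toric_varietyP => u v Auv.
have scaleE (w : 'cV[nat]_N) : \prod_i (\col_j (g (b j) * p j 0)) i 0 ^+ w i 0 =
    \prod_d g d ^+ (A *m w) (lam d) 0 * \prod_i p i 0 ^+ w i 0.
  under eq_bigr do rewrite mxE exprMn.
  rewrite big_split /=; congr (_ * _); rewrite (partition_big b xpredT) //=.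
  apply: eq_bigr => d _; rewrite mxE -prodrXr [RHS](bigID (fun i => b i == d)) /=.
  rewrite [X in _ * X]big1 ?mulr1 => [|i /negbTE nbi]; last first.
    by rewrite lamE nbi mul0r expr0.
  by apply: eq_bigr => i /eqP bi; rewrite lamE bi eqxx mul1r.
by rewrite !scaleE Auv (pA _ _ Auv).
Qed.

Definition block_normalize (p : 'cV[R]_N) : 'cV[R]_N :=
  \col_i ((\sum_(j | b j == b i) p j 0)^-1 * p i 0).

Lemma block_sum_gt0 (p : 'cV[R]_N) d :
  (forall i, 0 <= p i 0) -> (exists2 i, b i = d & 0 < p i 0) ->
  0 < \sum_(i | b i == d) p i 0.
Proof.
move=> p0 [i bi pi]; rewrite (bigD1 i) /=; last by rewrite bi.
by rewrite ltr_pwDl // sumr_ge0.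
Qed.

Lemma block_normalize_simplex (p : 'cV[R]_N) :
  (forall i, 0 <= p i 0) -> (forall d, exists2 i, b i = d & 0 < p i 0) ->
  block_simplex (block_normalize p).
Proof.
move=> p0 pb; split=> [i|d].
  by rewrite mxE mulr_ge0 // invr_ge0 sumr_ge0.
rewrite -[RHS](@mulVf _ (\sum_(i | b i == d) p i 0)) ?gt_eqF ?block_sum_gt0 //.
by rewrite mulr_sumr; apply: eq_bigr => i /eqP bi; rewrite mxE bi.
Qed.

Lemma toric_variety_normalize (p : 'cV[R]_N) :
  toric_variety A p -> toric_variety A (block_normalize p).
Proof.
exact: (toric_variety_scale_block (fun d => (\sum_(j | b j == d) p j 0)^-1)).
Qed.

(** The lower bounds [e] serve to keep chosen coordinates away from 0, where [ln] is not
    continuous. *)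
Lemma compact_toric_block_simplex (e : 'I_N -> R) :
  compact [set x : 'rV[R]_N | [/\ toric_variety A x^T, block_simplex x^T &
                               forall i, e i <= x 0 i]].
Proof.
have box : compact [set x : 'rV[R]_N | forall i, `[Num.max 0 (e i), 1]%classic (x 0 i)].
  apply: (@rV_compact R N (fun i => `[Num.max 0 (e i), 1]%classic)) => i.
  exact: segment_compact.
have blk : closed (\bigcap_(d in [set: D])
    ((fun x : 'rV[R]_N => (real_mx R A *m x^T) (lam d) 0) @^-1` [set r | r = 1])).
  apply: closed_bigI => d _; apply: preimage_closed; last exact: closed_eq.
  rewrite (_ : (fun x => _) = fun x : 'rV[R]_N => \sum_(i | b i == d) x 0 i).
    have addc : continuous (fun x : R * R => x.1 + x.2) by exact: add_continuous.
    move=> x _; apply: (continuous_big addc) => i _; exact: coord_continuous.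
  by apply/funext => x; rewrite block_sumE; apply: eq_bigr => i _; rewrite mxE.
have := compact_closedI (compact_closedI box blk) (@closed_toric_variety R k N A).
congr compact; apply/seteqP; split => x /=.
  move=> [[xbox xblk] xA]; split=> //.
    apply/block_simplexP; split=> [i|d]; last exact: xblk.
    by have := xbox i; rewrite /= in_itv /= ge_max mxE => /andP[/andP[]].
  by move=> i; have := xbox i; rewrite /= in_itv /= ge_max => /andP[/andP[]].
move=> [xA xD xe]; split=> //; split.
  move=> i; rewrite /= in_itv /= ge_max xe andbT.
  have := block_simplex_le1 i xD; have [+ _] := xD => /(_ i).
  by rewrite mxE => -> ->.
by move=> d _ /=; have /block_simplexP[_] := xD; apply.
Qed.

(** * Maximum likelihood and surjectivity of the moment map *)

Definition log_likelihood (q x : 'cV[R]_N) : R :=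
  \sum_(j | 0 < q j 0) q j 0 * ln (x j 0).

(** Entries of [x] are at most 1, so no term is positive and dropping the others can only increase
    the sum. *)
Lemma log_likelihood_le (q x : 'cV[R]_N) j : block_simplex x -> 0 < q j 0 ->
  log_likelihood q x <= q j 0 * ln (x j 0).
Proof.
move=> xD qj; rewrite /log_likelihood (bigD1 j) //= gerDl.
apply: sumr_le0 => i /andP[qi _].
by rewrite pmulr_rle0 // ln_le0 // block_simplex_le1.
Qed.

(** The all-ones vector satisfies every binomial equation; normalizing it gives a positive point of
    the model. *)
Lemma uniform_toric : exists u : 'cV[R]_N,
  [/\ toric_variety A u, block_simplex u & forall i, 0 < u i 0].
Proof.
pose v : 'cV[R]_N := const_mx 1.
have v0 i : 0 < v i 0 by rewrite mxE.
have vb d : exists2 i, b i = d & 0 < v i 0 by exists (sec d).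
exists (block_normalize v); split.
- apply: toric_variety_normalize; apply/toric_varietyP => x y _.
  by rewrite !big1 // => i _; rewrite mxE expr1n.
- by apply: block_normalize_simplex => // i; exact: ltW.
- move=> i; rewrite mxE mulr_gt0 // invr_gt0 block_sum_gt0 //.
  by move=> j; exact: ltW.
Qed.

(* [ln] is discontinuous at 0 (junk value [ln 0 = 0]); but where the likelihood
   is at least that of a positive point [u], each [x j 0] with [0 < q j 0] is
   bounded below, and the maximum can be taken over a compact set. *)
Lemma max_likelihood (q : 'cV[R]_N) : exists p : 'cV[R]_N,
  [/\ toric_variety A p, block_simplex p, forall i, 0 < q i 0 -> 0 < p i 0 &
   forall x, toric_variety A x -> block_simplex x ->
     (forall i, 0 < q i 0 -> 0 < x i 0) ->
     log_likelihood q x <= log_likelihood q p].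
Proof.
have [u [uA uD u0]] := uniform_toric.
(* If [x] is at least as likely as [u], then [log_likelihood q u <= q i 0 * ln (x i 0)]; solving for
   [x i 0] gives this bound. *)
pose e i := if 0 < q i 0 then expR (log_likelihood q u / q i 0) else 0.
pose K := [set x : 'rV[R]_N | [/\ toric_variety A x^T, block_simplex x^T &
                               forall i, e i <= x 0 i]].
have inK x : toric_variety A x -> block_simplex x ->
    (forall i, 0 < q i 0 -> 0 < x i 0) ->
    log_likelihood q u <= log_likelihood q x -> K x^T.
  move=> xA xD x0 lux; split=> [||i]; rewrite ?trmxK // mxE /e.
  case: ifP => [qi|_]; last by case: xD.
  rewrite -[leRHS]lnK ?posrE ?x0 // ler_expR ler_pdivrMr // mulrC.
  exact/(le_trans lux)/log_likelihood_le.
have Kpos x i : K x -> 0 < q i 0 -> 0 < x 0 i.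
  move=> [_ _ xe] qi; have := xe i; rewrite /e qi.
  by apply: lt_le_trans; exact: expR_gt0.
have [p /set_mem pK pmax] : exists2 p, p \in K & forall x, x \in K ->
    log_likelihood q x^T <= log_likelihood q p^T.
  apply: (@compact_EVT_max _ R (fun x : 'rV[R]_N => log_likelihood q x^T) K).
  - by exists u^T; exact: inK.
  - exact: compact_toric_block_simplex.
  - apply: continuous_in_subspaceT => x /set_mem xK.
    have addc : continuous (fun x : R * R => x.1 + x.2) by exact: add_continuous.
    apply: (cvg_big addc (nbhs_filter x)) => i qi.
    apply: cvgM; first exact: cvg_cst.
    have -> : (fun y : 'rV[R]_N => ln (y^T i 0)) =
        ln (R:=R) \o (fun y : 'rV[R]_N => y 0 i).
      by apply/funext => y /=; rewrite mxE.
    rewrite mxE.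
    apply: (@continuous_comp _ _ _ (fun y : 'rV[R]_N => y 0 i) (@ln R) x).
      exact: coord_continuous.
    exact/continuous_ln/Kpos.
have [pA pD _] := pK.
exists p^T; split=> // [i qi|x xA xD x0].
  by rewrite mxE; exact: Kpos.
(* A competitor less likely than [u] may lie outside [K], but it is dominated by [u], which lies in
   [K]. *)
have [lux|] := leP (log_likelihood q u) (log_likelihood q x).
  by rewrite -[x in leLHS]trmxK; apply: pmax; apply/mem_set; exact: inK.
move=> /ltW lxu; apply: (le_trans lxu).
by rewrite -[u]trmxK; apply: pmax; apply/mem_set; exact: inK.
Qed.

(* First-order condition for the likelihood at its maximum [p] along the curve
   [s |-> p_i * expR (s * A r i)], renormalized on each block. *)
Lemma toric_moment_onto (q : 'cV[R]_N) : block_simplex q ->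
  exists p, [/\ toric_variety A p, block_simplex p &
                real_mx R A *m p = real_mx R A *m q].
Proof.
move=> qD; have [p [pA pD pq pmax]] := max_likelihood q.
exists p; split=> //; apply/colP => r; rewrite !real_mx_mulE; symmetry.
under [RHS]eq_bigr do rewrite mulrC.
apply: expR_tangent => s.
have [p0 pb] := pD; have [q0 qb] := qD.
pose c : 'cV[R]_N := \col_i (expR s ^+ A r i * p i 0).
have cpos i : 0 < p i 0 -> 0 < c i 0.
  by move=> pi; rewrite mxE mulr_gt0 // exprn_gt0 // expR_gt0.
have c0 i : 0 <= c i 0 by rewrite mxE mulr_ge0 // exprn_ge0 // expR_ge0.
have cb d : exists2 i, b i = d & 0 < c i 0.
  have : 0 < \sum_(i | b i == d) p i 0 by rewrite pb.
  rewrite lt0r => /andP[/eqP psum _].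
  have [/existsP[i /andP[/eqP bi pi]]|] := boolP [exists i, (b i == d) && (0 < p i 0)].
    by exists i => //; exact: cpos.
  rewrite negb_exists => /forallP np; case: psum; apply: big1 => i /eqP bi.
  have := np i; rewrite bi eqxx /= -leNgt => pi.
  by apply/eqP; rewrite eq_le pi p0.
pose Z d := \sum_(i | b i == d) c i 0.
have Z0 d : 0 < Z d by exact: block_sum_gt0.
have := pmax (block_normalize c).
move=> /(_ (toric_variety_normalize (toric_variety_scale_row r _ pA))).
move=> /(_ (block_normalize_simplex c0 cb)).
have -> : log_likelihood q (block_normalize c) =
    log_likelihood q p + \sum_(j | 0 < q j 0) q j 0 * (s * (A r j)%:R - ln (Z (b j))).
  rewrite -big_split; apply: eq_bigr => j qj /=.
  rewrite mxE mxE lnM ?posrE ?invr_gt0 ?Z0 // ?mulr_gt0 ?exprn_gt0 ?expR_gt0 ?pq //.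
  rewrite lnV ?posrE ?Z0 // lnM ?posrE ?exprn_gt0 ?expR_gt0 ?pq //.
  by rewrite -expRM_natr expRK; ring.
(* By [sum_blocks] the normalizers contribute the sum of the [ln (Z d)]; maximality of [p] then
   bounds [s] times the moment of [q] by that sum. *)
have -> : \sum_(j | 0 < q j 0) q j 0 * (s * (A r j)%:R - ln (Z (b j))) =
    s * \sum_i (A r i)%:R * q i 0 - \sum_d ln (Z d).
  rewrite -(sum_blocks _ qD) mulr_sumr -sumrB big_mkcond.
  apply: eq_bigr => i _; case: ltP => [_|qi]; first by ring.
  have -> : q i 0 = 0 by apply/eqP; rewrite eq_le qi q0.
  by ring.
rewrite gerDl subr_le0 => le_sZ.
apply: le_trans (le_sZ _) _.
  by move=> i qi; rewrite mxE mulr_gt0 // ?invr_gt0 ?Z0 // cpos // pq.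
(* The bound [ln z <= z - 1] removes the logarithms, and the sum of the [Z d - 1] is the right-hand
   side that [expR_tangent] expects. *)
apply: (@le_trans _ _ (\sum_d (Z d - 1))).
  apply: ler_sum => d _; have := le_ln1Dx (x := Z d - 1).
  by rewrite (addrC 1) subrK; apply; have := Z0 d; lra.
rewrite (partition_big b xpredT) //=; apply: ler_sum => d _.
rewrite -[X in Z d - X](pb d) -sumrB; apply: ler_sum => i _.
by rewrite mxE -expRM_natr mulrBr mulr1 mulrC.
Qed.

(** * Relative interiors and faces of the marginal polytope *)

Lemma block_simplex_convex (x y : 'cV[R]_N) (a : R) :
  block_simplex x -> block_simplex y -> 0 < a < 1 ->
  block_simplex (a *: x + (1 - a) *: y).
Proof.
move=> [x0 xb] [y0 yb] /andP[a0 a1]; split=> [i|d].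
  by rewrite !mxE addr_ge0 // mulr_ge0 // ltW // subr_gt0.
under eq_bigr do rewrite !mxE.
by rewrite big_split /= -!mulr_sumr xb yb; ring.
Qed.

(** A positive preimage of [t] gives positive preimages of all nearby points of the column space.
    For the polytope, the affine hull also fixes the coordinates [lam d] at 1, which puts these
    preimages in the block simplex. *)
Lemma ri_block_image t : [set real_mx R A *m x | x in block_simplex] t ->
  ri [set real_mx R A *m x | x in block_simplex] t <-> ri (marginal_cone A) t.
Proof.
move=> Pt; rewrite marginal_coneE.
have [u [_ uD u0]] := uniform_toric.
have lamP s : [set real_mx R A *m x | x in block_simplex] s ->
    forall d, s (lam d) 0 = 1.
  by move=> [x /block_simplexP[_ xb] <-].
split=> [|riC].
  move=> /(ri_image_pos (fun x (xD : block_simplex x) => xD.1) block_simplex_convex uD).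
  move=> [x [[x0 _] <- xpos]]; split; first by exists x.
  near=> y => /affine_hull_image yM.
  have [x' x'0 ->] : exists2 x' : 'cV[R]_N,
      (forall i, 0 < x' i 0) & y = real_mx R A *m x'.
    move: yM; near: y; apply: near_pos_preimage => i; exact: xpos.
  by exists x' => // i; exact: ltW.
split=> //.
have [|x y a x0 y0 /andP[a0 a1] i||x [x0 xt xpos]] :=
  ri_image_pos _ _ _ riC (x0 := const_mx 1).
- by [].
- by rewrite !mxE addr_ge0 // mulr_ge0 // ?ltW // subr_gt0.
- by move=> i; rewrite mxE.
rewrite -xt in Pt *; near=> y => yaff.
have yM := affine_hull_image yaff.
have [x' x'0 yE] : exists2 x' : 'cV[R]_N,
      (forall i, 0 < x' i 0) & y = real_mx R A *m x'.
  by move: yM; near: y; apply: near_pos_preimage => i; apply: xpos; rewrite mxE.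
exists x' => //; apply/block_simplexP; split=> [i|d]; first exact: ltW.
by rewrite -yE; apply: affine_hull_coord yaff => s /lamP.
Unshelve. all: by end_near. Qed.

(** The form [c] is maximal exactly at the points supported in [F], the coordinates optimal in their
    block. Relative interior points of the face have preimages of full support [F], and [toric_supp]
    transfers this support to [p]. *)
Lemma face_facial (G : set 'cV[R]_k) :
  is_face [set real_mx R A *m x | x in block_simplex] G -> G !=set0 ->
  exists F, facial_set R A F /\
    forall p t, toric_variety A p -> block_simplex p -> real_mx R A *m p = t ->
      ri G t -> F = supp p.
Proof.
move=> [c [a [Pa ->]]] G0.
pose f i := (c^T *m col i (real_mx R A)) 0 0.
have cE (x : 'cV[R]_N) : (c^T *m (real_mx R A *m x)) 0 0 = \sum_i x i 0 * f i.
  rewrite mulmxA mxE; apply: eq_bigr => i _; rewrite mulrC; congr (_ * _).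
  by rewrite /f !mxE; apply: eq_bigr => r _; rewrite !mxE.
pose best d := [arg max_(i > sec d | b i == d) f i]%O.
pose h d := f (best d).
have bestP d : b (best d) = d /\ forall i, b i = d -> f i <= h d.
  rewrite /h /best; case: arg_maxP => [|i /eqP bi imax]; first by rewrite secK.
  by split=> // j /eqP; exact: imax.
have fh i : f i <= h (b i) by apply: (bestP (b i)).2.
pose F := [set i | f i == h (b i)]%SET.
(* The optimum of [c] over the product of simplices is the sum of its optima
   on the blocks. *)
have aE : a = \sum_d h d.
  apply/eqP; rewrite eq_le; apply/andP; split.
    (* A point of [G] attains [a], so [a] is at most the sum of the optima; validity at the vertex
       [v] gives the converse. *)
    have [_ [[x xD <-] <-]] := G0; rewrite cE -(sum_blocks h xD).
    by apply: ler_sum => i _; rewrite ler_wpM2l //; case: xD.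
  pose v : 'cV[R]_N := \col_i (i == best (b i))%:R.
  have vD : block_simplex v.
    split=> [i|d]; first by rewrite mxE ler0n.
    rewrite (bigD1 (best d)) /=; last by rewrite (bestP d).1.
    rewrite mxE (bestP d).1 eqxx big1 ?addr0 // => i /andP[/eqP bi ni].
    by rewrite mxE bi (negbTE ni).
  have := Pa (real_mx R A *m v); rewrite cE -(sum_blocks h vD).
  rewrite (eq_bigr (fun i => v i 0 * h (b i))) => [|i _]; first by apply; exists v.
  by rewrite mxE; case: eqP => [{1}->|_]; rewrite ?mul0r.
have faceE x : block_simplex x ->
    ((c^T *m (real_mx R A *m x)) 0 0 = a <-> supp x \subset F).
  move=> xD; rewrite cE aE -(sum_blocks h xD); split=> [/eqP|/fintype.subsetP xF].
    rewrite eq_sym -subr_eq0 -sumrB psumr_eq0 => [/allP xF|i _]; last first.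
      by rewrite -mulrBr mulr_ge0 ?subr_ge0 //; case: xD.
    apply/fintype.subsetP => i; rewrite !inE => xi; have := xF i.
    rewrite mem_index_enum => /(_ isT); rewrite -mulrBr mulf_eq0 (negbTE xi) /=.
    by rewrite subr_eq0 eq_sym.
  apply: eq_bigr => i _; have [->|xi] := eqVneq (x i 0) 0; first by rewrite !mul0r.
  by have := xF i; rewrite !inE => /(_ xi)/eqP ->.
exists F; split.
  (* Row [lam d] is the indicator of block [d], so the correction lowers the form by [h d] on that
     block. *)
  exists (c - \sum_d h d *: delta_mx (lam d) 0).
  have c'E i : ((c - \sum_d h d *: delta_mx (lam d) 0)^T *m col i (real_mx R A)) 0 0
      = f i - h (b i).
    rewrite linearB /= mulmxBl [LHS]mxE [X in _ + X]mxE; congr (_ - _).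
    rewrite linear_sum /= mulmx_suml summxE (bigD1 (b i)) //= big1 => [|d nd].
      by rewrite linearZ /= trmx_delta -scalemxAl -rowE !mxE lamE eqxx mulr1 addr0.
    by rewrite linearZ /= trmx_delta -scalemxAl -rowE !mxE lamE eq_sym
      (negbTE nd) mulr0.
  split=> i; rewrite inE c'E; first by move/eqP ->; rewrite subrr.
  by move=> fi; rewrite subr_lt0 lt_neqAle fi fh.
pose X := block_simplex `&` [set x | supp x \subset F].
have -> : [set real_mx R A *m x | x in block_simplex] `&`
    [set x | (c^T *m x) 0 0 = a] = [set real_mx R A *m x | x in X].
  apply/seteqP; split=> y /=; first by move=> [[x xD <-] /(faceE x xD) xF]; exists x.
  by move=> [x [xD /(faceE x xD) xF] <-]; split=> //; exists x.
(* Normalizing the indicator of [F] gives a point of [X] that is positive on all of [F]. *)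
pose w : 'cV[R]_N := \col_i (i \in F)%:R.
have w0 i : 0 <= w i 0 by rewrite mxE ler0n.
have wb d : exists2 i, b i = d & 0 < w i 0.
  by exists (best d); rewrite ?mxE ?inE (bestP d).1 // eqxx.
have wX : X (block_normalize w).
  split; first exact: block_normalize_simplex.
  apply/fintype.subsetP => i; rewrite !inE !mxE !inE; apply: contraNT => /negbTE ->.
  by rewrite mulr0.
have X0 x : X x -> forall i, 0 <= x i 0 by move=> [[]].
have Xconv x y e : X x -> X y -> 0 < e < 1 -> X (e *: x + (1 - e) *: y).
  move=> [xD /= /fintype.subsetP xF] [yD /= /fintype.subsetP yF] e01.
  split; first exact: block_simplex_convex.
  apply/fintype.subsetP => i; move: (xF i) (yF i); rewrite !inE !mxE => {}xF {}yF.
  apply: contraNT => fi; rewrite (eqP (contraNT xF fi)) (eqP (contraNT yF fi)).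
  by rewrite !mulr0 addr0.
move=> p t pA pD pt riX.
have [x [[xD /= xF] xt xpos]] := ri_image_pos X0 Xconv wX riX.
have suppx : supp x = F.
  apply/eqP; rewrite finset.eqEsubset xF /=; apply/fintype.subsetP => i iF.
  rewrite inE gt_eqF // xpos // mxE mulr_gt0 //.
    by rewrite invr_gt0; exact: block_sum_gt0.
  by rewrite mxE iF.
rewrite -suppx; symmetry; apply: (toric_supp pA); first by case: xD.
  by rewrite suppx; apply/(faceE p pD); rewrite pt -xt; apply/(faceE x xD).
by rewrite pt.
Qed.

End BlockSimplex.

(** * Application to the p_1 design matrices *)

Definition dyad_of n (i : 'I_#|coordinate n|) : dyad n := (enum_val i).1.

Definition lambda_param (m : p1_model) n (d : dyad n) : param m n :=
  match m with
  | Zmodel => inl (inl (inl d))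
  | Cmodel => inl (inl (inl (inl d)))
  | Emodel => inl (inl (inl (inl (inl d))))
  end.

Lemma design_lambda m n (d : dyad n) i :
  design m n (enum_rank (lambda_param m d)) i = (dyad_of i == d) :> nat.
Proof. by rewrite mxE enum_rankK eq_sym; case: m. Qed.

Lemma dyad_of_rank n :
  cancel (fun d : dyad n => enum_rank (d, ord0 : 'I_4)) (@dyad_of n).
Proof. by move=> d; rewrite /dyad_of enum_rankK. Qed.

Lemma DnE (R : realType) n : Dn (R := R) (n := n) = block_simplex (@dyad_of n).
Proof.
have sumE (p : 'cV[R]_#|coordinate n|) d :
    \sum_l block p d l 0 = \sum_(i | dyad_of i == d) p i 0.
  rewrite (reindex_onto (fun l : 'I_4 => enum_rank (d, l))
    (fun i => (enum_val i).2)) /=.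
    apply: eq_big => [l|l _]; last by rewrite mxE.
    by rewrite /dyad_of enum_rankK !eqxx.
  by move=> i /eqP <-; rewrite /dyad_of -surjective_pairing enum_valK.
apply/seteqP; split => p pD.
  split=> [i|d]; last by rewrite -sumE; have [] := pD d.
  have [/(_ (enum_val i).2) + _] := pD (dyad_of i).
  by rewrite mxE /dyad_of -surjective_pairing enum_valK.
move=> d; split=> [l|]; first by rewrite mxE; case: pD.
by rewrite sumE; case: pD.
Qed.

Theorem theorem4p4 (R : realType) (n : nat) (hn : (2 <= n)%N) (m : p1_model) :
  (forall t : 'cV[R]_#|param m n|,
     marginal_polytope (design m n) t ->
     (ri (marginal_polytope (design m n)) t <->
      ri (marginal_cone (design m n)) t)) /\
  (forall G : set 'cV[R]_#|param m n|,
     is_face (marginal_polytope (design m n)) G -> G !=set0 ->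
     exists F : {set 'I_#|coordinate n|},
       facial_set R (design m n) F /\
       forall t, ri G t -> F = supp (mu_inv (design m n) t)).
Proof.
have lamE := @design_lambda m n; have secK := @dyad_of_rank n.
have PE : marginal_polytope (design m n) =
    [set real_mx R (design m n) *m x | x in block_simplex (@dyad_of n)].
  by rewrite /marginal_polytope DnE.
split=> [t|G]; rewrite PE => Pt; first exact: (ri_block_image lamE secK Pt).
have GP t : G t -> marginal_polytope (design m n) t.
  by rewrite PE; have [c [a [_ ->]]] := Pt; case.
(* [mu_inv] has the default value 0 outside the image of the toric model; surjectivity excludes this
   default on the polytope. *)
have onto : set_surj (toric_model (design m n)) (marginal_polytope (design m n))
    (mu (R := R) (design m n)).
  move=> t; rewrite PE => -[q qD <-].
  have [p [pA pD pq]] := toric_moment_onto lamE secK qD.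
  by exists p => //; split=> //; rewrite DnE.
move=> G0; have [F [Ffacial FE]] := face_facial lamE secK Pt G0.
exists F; split=> // t riGt; have Pt' := GP t riGt.1.
have [pA pD] : toric_model (design m n) (mu_inv (design m n) t).
  by apply: (surjpinv_image_sub onto); exists t.
apply: FE riGt => //; first by rewrite -DnE.
have [p pT <-] := onto t Pt'.
by apply: (pinvK (fun=> 0)); apply/mem_set; exists p.
Qed.
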